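(* If $M$ is a compact piecewise linear $2$-manifold in $\mathbb{R}^3$, then there exists $N\in\mathbb{N}$ such that $\mathrm{Lip}((M,d_K),\mathbb{R}^N)<\infty$.
   Context: The Korányi metric on $\mathbb{R}^3$ is $d_K(p,q)=\big(((x-x')^2+(y-y')^2)^2+16(z-z'+\tfrac12(xy'-x'y))^2\big)^{1/4}$ for $p=(x,y,z)$, $q=(x',y',z')$. A map $f:(X,d_X)\to(Y,d_Y)$ is $L$-bi-Lipschitz if $L^{-1}d_X(a,b)\le d_Y(f(a),f(b))\le L d_X(a,b)$ for all $a,b$; $\mathrm{Lip}(X,Y)$ is the infimum of such $L$ over all maps $X\to Y$ ($\infty$ if no bi-Lipschitz map exists). $\mathbb{R}^N$ carries the Euclidean metric. *)

(* Defs.v *)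
From mathcomp Require Import all_boot all_order all_algebra.
From mathcomp Require Import reals.
Set Implicit Arguments. Unset Strict Implicit. Unset Printing Implicit Defensive.
Import Order.TTheory GRing.Theory Num.Theory.
Local Open Scope ring_scope.

Section Defs.
Variable R : realType.

Definition pt3 := (R * R * R)%type.
Definition pt2 := (R * R)%type.

(* Korányi metric on R^3 (Heisenberg group) *)
Definition dK (p q : pt3) : R :=
  let: (x, y, z) := p in let: (x', y', z') := q in
  Num.sqrt (Num.sqrt (((x - x') ^+ 2 + (y - y') ^+ 2) ^+ 2
     + 16 * (z - z' + 2^-1 * (x * y' - x' * y)) ^+ 2)).

Definition eucl3 (p q : pt3) : R :=
  let: (x, y, z) := p in let: (x', y', z') := q in
  Num.sqrt ((x - x') ^+ 2 + (y - y') ^+ 2 + (z - z') ^+ 2).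
Definition eucl2 (p q : pt2) : R :=
  let: (x, y) := p in let: (x', y') := q in
  Num.sqrt ((x - x') ^+ 2 + (y - y') ^+ 2).
Definition euclN (N : nat) (u v : 'rV[R]_N) : R :=
  Num.sqrt (\sum_(i < N) (u 0 i - v 0 i) ^+ 2).

Definition triangle (a b c : pt3) (p : pt3) : Prop :=
  exists s t u : R, [/\ 0 <= s, 0 <= t, 0 <= u, s + t + u = 1 &
    p = (s * a.1.1 + t * b.1.1 + u * c.1.1,
         s * a.1.2 + t * b.1.2 + u * c.1.2,
         s * a.2 + t * b.2 + u * c.2)].

Definition polyhedron (M : pt3 -> Prop) : Prop :=
  exists T : seq (pt3 * pt3 * pt3),
    forall p, M p <-> exists2 abc, abc \in T & triangle abc.1.1 abc.1.2 abc.2 p.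

Definition cont_on3 (A : pt3 -> Prop) (f : pt3 -> pt2) : Prop :=
  forall x, A x -> forall e : R, 0 < e -> exists2 d : R, 0 < d &
    forall y, A y -> eucl3 y x < d -> eucl2 (f y) (f x) < e.
Definition cont_on2 (A : pt2 -> Prop) (f : pt2 -> pt3) : Prop :=
  forall x, A x -> forall e : R, 0 < e -> exists2 d : R, 0 < d &
    forall y, A y -> eucl2 y x < d -> eucl3 (f y) (f x) < e.

Definition open2 (V : pt2 -> Prop) : Prop :=
  forall v, V v -> exists2 e : R, 0 < e & forall w, eucl2 w v < e -> V w.

Definition surface (M : pt3 -> Prop) : Prop :=
  forall x, M x -> exists2 r : R, 0 < r &
    let U := fun p => M p /\ eucl3 p x < r in
    exists (V : pt2 -> Prop) (phi : pt3 -> pt2) (psi : pt2 -> pt3),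
      open2 V /\
      (forall p, U p -> V (phi p)) /\
      (forall v, V v -> U (psi v)) /\
      (forall p, U p -> psi (phi p) = p) /\
      (forall v, V v -> phi (psi v) = v) /\
      cont_on3 U phi /\ cont_on2 V psi.

Definition compact_PL_2manifold (M : pt3 -> Prop) : Prop :=
  polyhedron M /\ surface M.

Definition Lip_finite (M : pt3 -> Prop) (N : nat) : Prop :=
  exists (f : pt3 -> 'rV[R]_N) (L : R), 0 < L /\
    forall p q, M p -> M q ->
      L^-1 * dK p q <= euclN (f p) (f q) /\ euclN (f p) (f q) <= L * dK p q.

End Defs.

(* Main.v *)
Require Import Defs.
From mathcomp Require Import all_boot all_order all_algebra.
From mathcomp Require Import reals.
From mathcomp Require Import boolp classical_sets ring lra.
Set Implicit Arguments. Unset Strict Implicit. Unset Printing Implicit Defensive.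
Import Order.TTheory GRing.Theory Num.Theory.
Local Open Scope ring_scope.

(* A polyhedron is a finite union of triangles, so it is enough to embed each triangle
   and to glue.  Gluing (Lang-Plaut): given embeddings f of A and g of B, extend both to
   Lipschitz maps F, G on A ∪ B; then (F, G, d(., A)) is an embedding.
   For one triangle, d_K^2 is comparable to |Δ(x,y)|^2 + |vertical part|.
   In a vertical plane the vertical part is the difference of an affine function ζ, so
   (x, y, g(ζ)) works, g being an embedding of the 1/2-snowflake of an interval.
   A nonvertical plane can be left-translated to z = 0, where the squared distance is
   comparable to |P - Q|^2 + |P ∧ Q|: the cone over the 1/2-snowflake of the circle,
   which embeds by r u |-> (r, r g(u_1), r g(u_2)).
   The map g is a Weierstrass type function solving G(t) = φ(t) + G(64 t) / 8. *)

(** * Embeddability and gluing *)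

(** A list of coordinate functions, rather than a row vector, lets embeddings be concatenated
    without dimension arithmetic. *)
Definition sqdist (R : realType) (T : Type) (fs : seq (T -> R)) (p q : T) : R :=
  \sum_(f <- fs) (f p - f q) ^+ 2.

(** [D] plays the role of a squared distance: squared coordinates simply add up, and the snowflake
    of a metric is obtained by taking the metric itself as [D]. *)
Definition embeddable (R : realType) (T : Type) (A : T -> Prop) (D : T -> T -> R) :=
  exists fs (L : R), 0 < L /\ forall p q, A p -> A q ->
    D p q <= L * sqdist fs p q /\ sqdist fs p q <= L * D p q.

Definition pseudometric (R : realType) (T : Type) (d : T -> T -> R) :=
  [/\ forall x, d x x = 0, forall x y, d x y = d y x &
      forall x y z, d x z <= d x y + d y z].

Lemma sqdist_ge0 (R : realType) (T : Type) (fs : seq (T -> R)) p q :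
  0 <= sqdist fs p q.
Proof. by apply: sumr_ge0 => f _; exact: sqr_ge0. Qed.

Lemma sqdist_sym (R : realType) (T : Type) (fs : seq (T -> R)) p q :
  sqdist fs p q = sqdist fs q p.
Proof. by apply: eq_bigr => f _; rewrite -sqrrN opprB. Qed.

Lemma sqdist_cat (R : realType) (T : Type) (fs gs : seq (T -> R)) p q :
  sqdist (fs ++ gs) p q = sqdist fs p q + sqdist gs p q.
Proof. exact: big_cat. Qed.

Lemma sqdist_cons (R : realType) (T : Type) (f : T -> R) fs p q :
  sqdist (f :: fs) p q = (f p - f q) ^+ 2 + sqdist fs p q.
Proof. exact: big_cons. Qed.

Lemma sqdist_nil (R : realType) (T : Type) (p q : T) :
  sqdist [::] p q = 0 :> R.
Proof. exact: big_nil. Qed.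

Lemma sqdist_trans (R : realType) (T : Type) (fs : seq (T -> R)) q p r :
  sqdist fs p r <= 2 * sqdist fs p q + 2 * sqdist fs q r.
Proof.
rewrite /sqdist !mulr_sumr -big_split; apply: ler_sum => f _ /=.
have := sqr_ge0 ((f p - f q) - (f q - f r)); nra.
Qed.

Lemma embeddable_sub (R : realType) (T : Type) (A B : T -> Prop) (D : T -> T -> R) :
  (forall p, A p -> B p) -> embeddable B D -> embeddable A D.
Proof.
by move=> AB [fs [L [L0 H]]]; exists fs, L; split=> // p q /AB Bp /AB Bq; exact: H.
Qed.

Lemma embeddable_equiv (R : realType) (T : Type) (A : T -> Prop)
    (D D' : T -> T -> R) (c : R) : 0 < c ->
  (forall p q, A p -> A q -> D p q <= c * D' p q /\ D' p q <= c * D p q) ->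
  embeddable A D -> embeddable A D'.
Proof.
move=> c0 DD' [fs [L [L0 H]]]; exists fs, (c * L); split; first exact: mulr_gt0.
move=> p q Ap Aq; have [H1 H2] := H p q Ap Aq; have [H3 H4] := DD' p q Ap Aq.
split.
  by rewrite -mulrA; apply: le_trans H4 _; rewrite ler_pM2l.
by apply: le_trans H2 _; rewrite [c * L]mulrC -mulrA ler_pM2l.
Qed.

Lemma embeddable_add (R : realType) (T : Type) (A : T -> Prop) (D D' : T -> T -> R) :
  embeddable A D -> embeddable A D' -> embeddable A (fun p q => D p q + D' p q).
Proof.
move=> [fs [L [L0 H]]] [gs [M [M0 K]]]; exists (fs ++ gs), (L + M).
split; first exact: addr_gt0.
move=> p q Ap Aq; have [H1 H2] := H p q Ap Aq; have [K1 K2] := K p q Ap Aq.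
rewrite sqdist_cat.
have Sf := sqdist_ge0 fs p q; have Sg := sqdist_ge0 gs p q.
(* No sign is assumed of [D]; it follows from the upper bound, as [L * D p q] dominates a sum of
   squares. *)
have D0 : 0 <= D p q by rewrite -(pmulr_rge0 _ L0); exact: le_trans H2.
have D'0 : 0 <= D' p q by rewrite -(pmulr_rge0 _ M0); exact: le_trans K2.
split; nra.
Qed.

Lemma embeddable_comp (R : realType) (S T : Type) (h : S -> T)
    (A : S -> Prop) (B : T -> Prop) (D : T -> T -> R) :
  (forall p, A p -> B (h p)) -> embeddable B D ->
  embeddable A (fun p q => D (h p) (h q)).
Proof.
move=> AB [fs [L [L0 H]]]; exists [seq f \o h | f <- fs], L; split=> // p q /AB Bp /AB Bq.
by rewrite /sqdist big_map; exact: H.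
Qed.

Lemma embeddable_sqr (R : realType) (T : Type) (A : T -> Prop) (f : T -> R) :
  embeddable A (fun p q => (f p - f q) ^+ 2).
Proof.
exists [:: f], 1; split=> // p q _ _.
by rewrite sqdist_cons sqdist_nil addr0 mul1r.
Qed.

Lemma ler_norm_of_sqr (R : realType) (x y : R) : 0 <= y -> x ^+ 2 <= y ^+ 2 -> `|x| <= y.
Proof. by move=> y0; rewrite -(real_normK (num_real x)) ler_sqr ?nnegrE. Qed.

Lemma pseudometric_ge0 (R : realType) (T : Type) (d : T -> T -> R) x y :
  pseudometric d -> 0 <= d x y.
Proof.
by case=> d0 ds dt; have := dt x y x; rewrite d0 (ds y x); lra.
Qed.

(** McShane extension: [F x] is the supremum of [f a - K * d x a] over [a] in [A]. The last clause
    says that the supremum is approached; for [f = 0] and [K = 1], [F] is minus the distance to [A]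
    and the clause yields nearly closest points. *)
Lemma lipschitz_extension (R : realType) (T : Type) (d : T -> T -> R)
    (A : T -> Prop) (f : T -> R) (K : R) (a0 : T) :
  pseudometric d -> 0 <= K -> A a0 ->
  (forall a b, A a -> A b -> `|f a - f b| <= K * d a b) ->
  exists F : T -> R, [/\ forall a, A a -> F a = f a,
    forall x y, `|F x - F y| <= K * d x y &
    forall x c, c < F x -> exists2 a, A a & c < f a - K * d x a].
Proof.
move=> dm K0 Aa0 Hf; have [d0 ds dt] := dm.
pose E x : set R := [set u | exists2 a, A a & u = f a - K * d x a]%classic.
have Hf' a b : A a -> A b -> f a - f b <= K * d a b.
  by move=> Aa Ab; apply: le_trans (ler_norm _) _; exact: Hf.
have Kt x y z : K * d x z <= K * d x y + K * d y z.
  by rewrite -mulrDr ler_wpM2l.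
have ubE x y u : E y u -> u <= sup (E x) + K * d x y.
  move=> [a Aa ->].
  have hub : has_sup (E x).
    split; first by exists (f a - K * d x a), a.
    exists (f a0 + K * d x a0) => _ [b Ab ->].
    by have := Hf' b a0 Ab Aa0; have := Kt b x a0; rewrite (ds b x); lra.
  have : f a - K * d x a <= sup (E x).
    by apply: ub_le_sup; [case: hub | exists a].
  by have := Kt x y a; lra.
have E0 x : (E x !=set0)%classic by exists (f a0 - K * d x a0), a0.
have supL x y : sup (E y) <= sup (E x) + K * d x y.
  by apply: ge_sup => // u; exact: ubE.
exists (fun x => sup (E x)); split.
- move=> a Aa; apply/eqP; rewrite eq_le; apply/andP; split.
    apply: ge_sup => // _ [b Ab ->].
    by have := Hf' b a Ab Aa; rewrite (ds b a); lra.
  have : E a (f a) by exists a => //; rewrite d0; lra.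
  by move/(ubE a); rewrite d0 mulr0 addr0.
- move=> x y; rewrite ler_norml; have := supL x y; have := supL y x.
  by rewrite (ds y x) => *; apply/andP; split; lra.
move=> x c cE.
have [u [a Aa ->] cu] := sup_gt (E0 x) cE.
by exists a.
Qed.

Lemma sqdist_extension (R : realType) (T : Type) (d : T -> T -> R)
    (A : T -> Prop) (a0 : T) (fs : seq (T -> R)) (L : R) :
  pseudometric d -> A a0 -> 0 <= L ->
  (forall p q, A p -> A q -> sqdist fs p q <= L * d p q ^+ 2) ->
  exists Fs (M : R), [/\ 0 <= M,
    forall p q, A p -> A q -> sqdist Fs p q = sqdist fs p q &
    forall p q, sqdist Fs p q <= M * d p q ^+ 2].
Proof.
move=> dm Aa0 L0; elim: fs => [|f fs IH] Hfs.
  exists [::], 0; split=> // p q; by rewrite sqdist_nil mul0r.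
have [|Fs [M [M0 FsE FsM]]] := IH.
  move=> p q Ap Aq; apply: le_trans (Hfs p q Ap Aq).
  by rewrite sqdist_cons; have := sqr_ge0 (f p - f q); lra.
(* The constant [1 + L] replaces the square root of [L], since [L <= (1 + L) ^+ 2]. *)
have [||F [FE FL _]] := @lipschitz_extension _ _ d A f (1 + L) a0 dm _ Aa0; first lra.
  move=> a b Aa Ab.
  have dab := pseudometric_ge0 a b dm.
  apply: ler_norm_of_sqr; first by apply: mulr_ge0 => //; lra.
  have := Hfs a b Aa Ab; rewrite sqdist_cons.
  have := sqdist_ge0 fs a b; have := sqr_ge0 (d a b).
  have := sqr_ge0 (L * d a b); rewrite !exprMn; nra.
exists (F :: Fs), ((1 + L) ^+ 2 + M); split.
- by apply: addr_ge0 => //; exact: sqr_ge0.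
- by move=> p q Ap Aq; rewrite !sqdist_cons FsE // !FE.
move=> p q; rewrite sqdist_cons mulrDl; apply: lerD => //.
rewrite -exprMn -(real_normK (num_real (F p - F q))) ler_sqr ?nnegrE //.
exact: le_trans (FL p q).
Qed.

Lemma embeddable_union (R : realType) (T : Type) (d : T -> T -> R) (A B : T -> Prop) :
  pseudometric d ->
  embeddable A (fun p q => d p q ^+ 2) -> embeddable B (fun p q => d p q ^+ 2) ->
  embeddable (fun p => A p \/ B p) (fun p q => d p q ^+ 2).
Proof.
move=> dm eA eB; have [d0 ds dt] := dm.
(* The extension needs a base point, so an empty piece is treated apart. *)
have [[a0 Aa0]|nA] := pselect (exists a, A a); last first.
  by apply: embeddable_sub eB => p [Ap|//]; case: nA; exists p.
have [[b0 Bb0]|nB] := pselect (exists b, B b); last first.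
  by apply: embeddable_sub eA => p [//|Bp]; case: nB; exists p.
case: eA => fs [L [L0 Hf]]; case: eB => gs [L' [L'0 Hg]].
have [|Fs [M [M0 FsE FsM]]] := sqdist_extension dm Aa0 (ltW L0) (fs := fs).
  by move=> p q Ap Aq; case: (Hf p q Ap Aq).
have [|Gs [M' [M'0 GsE GsM]]] := sqdist_extension dm Bb0 (ltW L'0) (fs := gs).
  by move=> p q Ap Aq; case: (Hg p q Ap Aq).
(* [del] is minus the distance to [A]. *)
have [||del [del0 delL delP]] := @lipschitz_extension _ _ d A (fun=> 0) 1 a0 dm _ Aa0.
- by [].
- by move=> a b _ _; rewrite subrr normr0 mul1r pseudometric_ge0.
(* If [d y a < c * d x y], then [a] stays at distance at least [3 / 4 * d x y] from [x] because
   [c <= 4^-1], and passing from [y] to [a] costs at most [d x y ^+ 2 / (16 * (1 + L))] in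
   [sqdist Fs], too little to spoil the separation of [x] and [a]. *)
pose c := (4 * (1 + L) * (1 + M))^-1.
have P0 : 0 < 4 * (1 + L) * (1 + M) by nra.
have c0 : 0 < c by rewrite invr_gt0.
have cE : c * (4 * (1 + L) * (1 + M)) = 1 by rewrite mulVf // gt_eqF.
have c4 : c <= 4^-1 by nra.
have c2M : c ^+ 2 * M <= (16 * (1 + L))^-1.
  rewrite -[leRHS]mul1r ler_pdivlMr; last lra.
  have E : c ^+ 2 * (4 * (1 + L) * (1 + M)) ^+ 2 = 1 by rewrite -exprMn cE expr1n.
  rewrite -[leRHS]E -[leLHS]mulrA ler_wpM2l ?sqr_ge0 //.
  have : M * (1 + L) <= (1 + M) ^+ 2 * (1 + L) ^+ 2 by apply: ler_pM; nra.
  rewrite !exprMn; nra.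
(* If [y] is far from [A] then [del] separates it from [x]; otherwise [y] is so
   close to some [a] in [A] that the extension of [f] separates [x] and [y]. *)
have cross x y : A x -> B y ->
    d x y ^+ 2 <= (c ^- 2 + 16 * (1 + L)) * (sqdist Fs x y + (del x - del y) ^+ 2).
  move=> Ax By; have dxy := pseudometric_ge0 x y dm.
  have sF := sqdist_ge0 Fs x y; rewrite (del0 x Ax) sub0r sqrrN.
  have [far|near] := leP (del y) (- (c * d x y)).
    have cd : 0 <= c * d x y by apply: mulr_ge0 => //; exact: ltW.
    have : (c * d x y) ^+ 2 <= del y ^+ 2.
      rewrite -[leRHS]sqrrN ler_sqr ?nnegrE; lra.
    rewrite exprMn -ler_pdivlMl ?exprn_gt0 // mulrC => h.
    have c20 : 0 <= c ^- 2 by rewrite invr_ge0 exprn_ge0 // ltW.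
    apply: le_trans h _; have := sqr_ge0 (del y); nra.
  have [a Aa] := delP y _ near; rewrite sub0r mul1r ltrN2 => dya.
  have dyap := pseudometric_ge0 y a dm.
  have dxa : 3 / 4 * d x y <= d x a.
    by have := dt x a y; rewrite (ds a y); nra.
  have [h _] := Hf x a Ax Aa; rewrite -(FsE x a Ax Aa) in h.
  have h2 := sqdist_trans Fs y x a; have h3 := FsM y a.
  have h4 : M * d y a ^+ 2 <= c ^+ 2 * M * d x y ^+ 2.
    rewrite [c ^+ 2 * M]mulrC -mulrA ler_wpM2l // -exprMn ler_sqr ?nnegrE //.
    - exact: ltW.
    - by apply: mulr_ge0 => //; exact: ltW.
  have h5 : c ^+ 2 * M * d x y ^+ 2 <= (16 * (1 + L))^-1 * d x y ^+ 2.
    by rewrite ler_wpM2r // sqr_ge0.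
  set D := d x y ^+ 2 in h4 h5 *.
  have h6 : 9 / 16 * D <= d x a ^+ 2 by rewrite /D; nra.
  have D0 : 0 <= D by exact: sqr_ge0.
  have sF1 := sqdist_ge0 Fs x a.
  have h7 : 9 / 16 * D <= (1 + L) * sqdist Fs x a by nra.
  have LV : (1 + L) * ((16 * (1 + L))^-1 * D) = D / 16.
    by field; rewrite gt_eqF //; lra.
  have h8 : D <= 16 * (1 + L) * sqdist Fs x y by nra.
  have c20 : 0 <= c ^- 2 by rewrite invr_ge0 exprn_ge0 // ltW.
  have := sqr_ge0 (del y); nra.
pose N := 1 + M + M' + L + L' + (c ^- 2 + 16 * (1 + L)).
have c20 : 0 <= c ^- 2 by rewrite invr_ge0 exprn_ge0 // ltW.
exists (del :: Fs ++ Gs), N; split; first by rewrite /N; nra.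
have bound k D S : 0 <= k -> k <= N -> 0 <= S -> D <= k * S -> D <= N * S.
  by move=> k0 kN S0 h; apply: le_trans h _; rewrite ler_wpM2r.
move=> p q Hp Hq; rewrite sqdist_cons sqdist_cat.
have sF := sqdist_ge0 Fs p q; have sG := sqdist_ge0 Gs p q.
have sd := sqr_ge0 (del p - del q).
split.
  case: Hp Hq => [Ap|Bp] [Aq|Bq].
  - have [h _] := Hf p q Ap Aq; rewrite -FsE // in h.
    by apply: (@bound L); rewrite /N; nra.
  - have h := cross p q Ap Bq.
    by apply: (@bound (c ^- 2 + 16 * (1 + L))); rewrite /N; nra.
  - have h := cross q p Aq Bp; rewrite ds sqdist_sym -(sqrrN (del q - del p)) opprB in h.
    by apply: (@bound (c ^- 2 + 16 * (1 + L))); rewrite /N; nra.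
  - have [h _] := Hg p q Bp Bq; rewrite -GsE // in h.
    by apply: (@bound L'); rewrite /N; nra.
have := FsM p q; have := GsM p q.
have : (del p - del q) ^+ 2 <= d p q ^+ 2.
  rewrite -(real_normK (num_real (del p - del q))) ler_sqr ?nnegrE ?pseudometric_ge0 //.
  by have := delL p q; rewrite mul1r.
have := sqr_ge0 (d p q); rewrite /N; nra.
Qed.

(** * The snowflake of an interval *)

(** This is the distance from [t] to the nearest half-odd integer: a 1-periodic function with slopes
    1 and -1. *)
Definition sawtooth (R : realType) (t : R) : R := `|t - (Num.floor t)%:~R - 2^-1|.

Lemma sawtooth_int (R : realType) (n : int) (t : R) :
  n%:~R <= t < n%:~R + 1 -> sawtooth t = `|t - n%:~R - 2^-1|.
Proof.
by move=> h; rewrite /sawtooth (@floor_def _ t n) // intrD.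
Qed.

Lemma floor_bounds (R : realType) (t : R) :
  exists n : int, n%:~R <= t < n%:~R + 1.
Proof.
exists (Num.floor t); rewrite floor_le_tmp /=.
by have := floorD1_gt t; rewrite intrD.
Qed.

Lemma sawtooth_bounds (R : realType) (t : R) : 0 <= sawtooth t <= 2^-1.
Proof.
have [n h] := floor_bounds t; rewrite (sawtooth_int h) normr_ge0 ler_norml /=.
by case/andP: h => *; apply/andP; split; lra.
Qed.

(** Reduces comparisons of sawtooth values to finitely many affine cases: same cell or consecutive
    cells. *)
Lemma floor_bounds_near (R : realType) (s t : R) : s <= t -> t < s + 1 ->
  exists n : int, n%:~R <= s < n%:~R + 1 /\
    (n%:~R <= t < n%:~R + 1 \/ (n + 1)%:~R <= t < (n + 1)%:~R + 1).
Proof.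
move=> st ts; have [n h] := floor_bounds s; exists n; split=> //.
rewrite intrD; have [tn|tn] := ltP t (n%:~R + 1); [left|right];
  by case/andP: h => *; apply/andP; split; lra.
Qed.

Lemma sawtooth_lip (R : realType) (s t : R) :
  `|sawtooth s - sawtooth t| <= `|s - t|.
Proof.
wlog st : s t / s <= t.
  move=> H; have [st|/ltW ts] := leP s t; first exact: H.
  by rewrite distrC [`|s - t|]distrC; exact: H.
have [ts|ts] := ltP t (s + 1); last first.
  have /andP[? ?] := sawtooth_bounds s; have /andP[? ?] := sawtooth_bounds t.
  by rewrite [`|s - t|]ler0_norm ?ler_norml; [apply/andP; split|]; lra.
have [n [hs ht]] := floor_bounds_near st ts.
rewrite [`|s - t|]ler0_norm; last lra.
rewrite (sawtooth_int hs).
case: ht => ht; rewrite (sawtooth_int ht) ?intrD;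
  case/andP: hs => ? ?; case/andP: ht; rewrite ?intrD => ? ?;
  rewrite ler_norml; apply/andP; split;
  by case: ger0P => ?; case: ger0P => ?; lra.
Qed.

(* The break points of the two functions are the multiples of [1/2] and the odd
   multiples of [1/4]: on an interval of length at most [1/4] one of them is affine. *)
Lemma sawtooth_separates (R : realType) (s t : R) : `|s - t| <= 4^-1 ->
  `|sawtooth s - sawtooth t| = `|s - t| \/
  `|sawtooth (s + 4^-1) - sawtooth (t + 4^-1)| = `|s - t|.
Proof.
wlog st : s t / s <= t.
  move=> H; have [st|/ltW ts] := leP s t; first exact: H.
  rewrite distrC [`|sawtooth s - _|]distrC [`|sawtooth (s + _) - _|]distrC; exact: H.
rewrite [`|s - t|]ler0_norm => [d4|]; last lra.
have [|n [/andP[ns ns1] ht]] := floor_bounds_near st; first lra.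
have n1 : (n + 1)%:~R = n%:~R + 1 :> R by rewrite intrD.
have st0 u v w : u - v = w \/ v - u = w -> 0 <= w -> `|u - v| = w.
  by case=> <- w0; [rewrite ger0_norm | rewrite distrC ger0_norm].
have d0 : 0 <= - (s - t) by lra.
case: ht => /andP[nt nt1].
  have [c|c] := leP t (n%:~R + 2^-1).
    left; rewrite !(@sawtooth_int _ n); try by apply/andP; split; lra.
    apply: st0 => //; left; rewrite !ler0_norm; lra.
  have [c'|c'] := leP (n%:~R + 2^-1) s.
    left; rewrite !(@sawtooth_int _ n); try by apply/andP; split; lra.
    apply: st0 => //; right; rewrite !ger0_norm; lra.
  (* The break point [n + 1/2] separates [s] from [t]; the shift by 1/4 moves both into the
     increasing half of the cell. *)
  have [c2|c2] := ltP t (n%:~R + 3 / 4).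
    right; rewrite !(@sawtooth_int _ n); try by apply/andP; split; lra.
    apply: st0 => //; right; rewrite !ger0_norm; lra.
  exfalso; lra.
right.
have [c|c] := ltP s (n%:~R + 3 / 4); first by exfalso; rewrite n1 in nt; lra.
rewrite !(@sawtooth_int _ (n + 1)) ?n1; try by apply/andP; split; rewrite ?n1 in nt nt1 *; lra.
apply: st0 => //; left; rewrite !ler0_norm; rewrite ?n1 in nt nt1 *; lra.
Qed.

(** [G] is the series of the [phi (64 ^+ n * t) / 8 ^+ n], taken as the supremum of its increasing
    partial sums. The bound is the geometric sum [2^-1 / (1 - 8^-1)]. As 8 is the square root of 64,
    [G] behaves like a 1/2-Hölder function. *)
Lemma weierstrass_exists (R : realType) (phi : R -> R) :
  (forall t, 0 <= phi t <= 2^-1) ->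
  exists G : R -> R, (forall t, 0 <= G t <= 4 / 7) /\
    (forall t, G t = phi t + G (64 * t) / 8).
Proof.
move=> hphi.
pose S := fix S n (t : R) : R := if n is n'.+1 then phi t + S n' (64 * t) / 8 else 0.
have S_bounds n t : 0 <= S n t <= 4 / 7.
  elim: n t => [|n IH] t /=; first by apply/andP; split; lra.
  by have /andP[? ?] := IH (64 * t); have /andP[? ?] := hphi t; apply/andP; split; lra.
have S_mono n t : S n t <= S n.+1 t.
  elim: n t => [|n IH] t; first by have /andP[] := S_bounds 1 t.
  by have := IH (64 * t); rewrite /=; lra.
pose E t : set R := [set u | exists n, u = S n t]%classic.
have E0 t : (E t !=set0)%classic by exists 0, 0.
have Eub t n : S n t <= sup (E t).
  by apply: ub_le_sup; [exists (4 / 7) => _ [m ->]; case/andP: (S_bounds m t) | exists n].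
exists (fun t => sup (E t)); split=> t.
  apply/andP; split; first exact: (Eub t 0).
  by apply: ge_sup => // _ [m ->]; case/andP: (S_bounds m t).
apply/eqP; rewrite eq_le; apply/andP; split.
  apply: ge_sup => // _ [n ->]; apply: le_trans (S_mono n t) _ => /=.
  by have := Eub (64 * t) n; lra.
suff : sup (E (64 * t)) <= 8 * (sup (E t) - phi t) by lra.
apply: ge_sup => // _ [n ->].
by have /= := Eub t n.+1; lra.
Qed.

(** Unrolling the equation [n] times leaves the first [n] terms of the series; the [i]-th is
    Lipschitz with constant [M * 8 ^+ i], and these constants sum to [M / 7 * (8 ^+ n - 1)]. *)
Lemma weierstrass_iter (R : realType) (phi G : R -> R) (M : R) :
  (forall s t, `|phi s - phi t| <= M * `|s - t|) ->
  (forall t, G t = phi t + G (64 * t) / 8) ->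
  forall n s t,
    `|G s - G t - (G (64 ^+ n * s) - G (64 ^+ n * t)) / 8 ^+ n|
      <= M / 7 * (8 ^+ n - 1) * `|s - t|.
Proof.
move=> phiM GE; elim=> [|n IH] s t.
  by rewrite !expr0 !mul1r divr1 !subrr normr0 mulr0 mul0r.
rewrite {1}(GE s) {1}(GE t) !exprS.
have := IH (64 * s) (64 * t); rewrite !mulrA ![_ ^+ n * 64]mulrC.
rewrite -[64 * s - _]mulrBr normrM ger0_norm //.
set a := G (64 * s); set b := G (64 * t).
set x := (X in a - b - X) => h.
have -> : phi s + a / 8 - (phi t + b / 8) -
   (G (64 * 64 ^+ n * s) - G (64 * 64 ^+ n * t)) / (8 * 8 ^+ n) =
   (phi s - phi t) + (a - b - x) / 8.
  by rewrite /x; field; rewrite expf_neq0 ?pnatr_eq0.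
apply: le_trans (ler_normD _ _) _.
rewrite normrM [`|8^-1|]ger0_norm ?invr_ge0 ?ler0n //.
have := phiM s t; have := normr_ge0 (s - t); nra.
Qed.

(** Take the least [m] with [8^-1 < 2 ^+ m * x] and divide it by 6, as [64 = 2 ^+ 6]: the quotient
    is the term of the series to look at, the remainder selects one of six dilations. *)
Lemma dyadic_scale (R : realType) (x : R) : 0 < x -> x <= 4^-1 ->
  exists n j, (j < 6)%N /\ 8^-1 < 2 ^+ j * (64 ^+ n * x) <= 4^-1.
Proof.
move=> x0 x4.
have exP : exists m, 8^-1 < 2 ^+ m * x.
  have [m hm] : exists m : nat, (8 * x)^-1 < 2 ^+ m.
    exists (Num.bound (8 * x)^-1); exact: upper_nthrootP.
  have x8 : 0 < 8 * x by rewrite mulr_gt0.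
  exists m; rewrite -(ltr_pM2l x8) mulfV ?gt_eqF // in hm; lra.
case: (ex_minnP exP) => m hm minm; exists (m %/ 6)%N, (m %% 6)%N.
split; first by rewrite ltn_mod.
have -> : 2 ^+ (m %% 6) * (64 ^+ (m %/ 6) * x) = 2 ^+ m * x.
  have -> : 64 = 2 ^+ 6 :> R by ring.
  by rewrite mulrA -exprM -exprD {3}(divn_eq m 6) addnC mulnC.
(* Minimality of [m] gives the upper bound [4^-1]; for [m = 0] it is the hypothesis on [x]. *)
rewrite hm /=; case: m minm {hm} => [|m] minm; first by rewrite expr0 mul1r.
have [//|h] := leP (2 ^+ m.+1 * x) 4^-1.
have := minm m; rewrite ltnn => /(_ _)/negP.
case=> //; first by move: h; rewrite exprS; lra.
Qed.

Lemma snowflake_interval (R : realType) :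
  embeddable (fun t : R => -1 <= t <= 1) (fun s t => `|s - t|).
Proof.
(* On the shorter interval [|s - t| <= 4^-1], as [dyadic_scale] requires. *)
suff H : embeddable (fun t : R => -8^-1 <= t <= 8^-1) (fun s t => `|s - t|).
  apply: (@embeddable_equiv _ _ _ (fun s t => `|s / 8 - t / 8|) _ 8) => //.
    move=> s t _ _; rewrite -mulrBl normrM [`|8^-1|]ger0_norm ?invr_ge0 ?ler0n //.
    by have := normr_ge0 (s - t); split; lra.
  apply: embeddable_comp H => t /andP[? ?]; apply/andP; split; lra.
(* Twelve functions: the dilations fill the gap between consecutive powers of 64, and the shift
   provides the second alternative of [sawtooth_separates]. *)
pose phi (k : 'I_6 * bool) (t : R) := sawtooth (2 ^+ k.1 * t + (if k.2 then 4^-1 else 0)).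
have phi_bounds k t : 0 <= phi k t <= 2^-1 by exact: sawtooth_bounds.
have phi_lip k s t : `|phi k s - phi k t| <= 2 ^+ k.1 * `|s - t|.
  apply: le_trans (sawtooth_lip _ _) _.
  by rewrite opprD addrACA subrr addr0 -mulrBr normrM ger0_norm // exprn_ge0.
have /choice[G HG] k := weierstrass_exists (phi_bounds k).
have osc k u v : `|G k u - G k v| <= 4 / 7.
  have /andP[? ?] := (HG k).1 u; have /andP[? ?] := (HG k).1 v.
  by rewrite ler_norml; apply/andP; split; lra.
have scale s t n : 64 ^+ n * `|s - t| = `|64 ^+ n * s - 64 ^+ n * t| :> R.
  by rewrite -mulrBr normrM ger0_norm // exprn_ge0.
have pow6 i : (i < 6)%N -> 1 <= (2 : R) ^+ i <= 32.
  move=> i6; rewrite exprn_ege1 ?ler1n //=.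
  by have -> : 32 = 2 ^+ 5 :> R; [ring | rewrite ler_weXn2l ?ler1n].
have E64 n : 64 ^+ n = (8 ^+ n) ^+ 2 :> R.
  by rewrite exprAC; congr (_ ^+ _); ring.
(* Both bounds compare [G s - G t] with its [n]-th term at the scale [64^-n] of [s - t]. *)
have upper k s t n j : (j < 6)%N -> 8^-1 < 2 ^+ j * (64 ^+ n * `|s - t|) <= 4^-1 ->
    (G k s - G k t) ^+ 2 <= 1024 * `|s - t|.
  move=> j6 /andP[h1 h2].
  have := weierstrass_iter (phi_lip k) (HG k).2 n s t.
  have j2 : 1 <= (2 : R) ^+ j <= 32.
    exact: pow6.
  have k2 : 1 <= (2 : R) ^+ k.1 <= 32.
    exact: pow6.
  move: h1 h2 j2 k2; rewrite E64; set e := 8 ^+ n; set x := `|s - t|.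
  set J := 2 ^+ j; set K := 2 ^+ _ => h1 h2 /andP[J1 J2] /andP[K1 K2].
  have e0 : 1 <= e by rewrite exprn_ege1 // ler1n.
  have x0 : 0 <= x by exact: normr_ge0.
  set d := G k s - G k t; have := osc k (e ^+ 2 * s) (e ^+ 2 * t).
  set o := G k _ - G k _ => ho hd.
  have oe : `|o / e| = `|o| / e by rewrite normrM normfV (@ger0_norm _ e) //; lra.
  have hd2 : `|d| <= K / 7 * (e - 1) * x + `|o| / e.
    by rewrite -oe; have := ler_normD (d - o / e) (o / e); rewrite subrK; lra.
  have y4 : e ^+ 2 * x <= 4^-1 by nra.
  (* From [J <= 32]. With [|d| * e <= 2] below, it gives the constant [1024 = 4 * 256]. *)
  have y256 : 256^-1 <= e ^+ 2 * x by nra.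
  have hde : `|d| * e <= 2.
    have : `|d| * e <= K / 7 * (e - 1) * x * e + `|o|.
      apply: le_trans (ler_wpM2r _ hd2) _; first lra.
      by rewrite mulrDl divfK // gt_eqF //; lra.
    have : (e - 1) * x * e <= 4^-1 by nra.
    have : 0 <= (e - 1) * x * e by apply: mulr_ge0; [apply: mulr_ge0|]; lra.
    nra.
  have hde2 : d ^+ 2 * e ^+ 2 <= 4.
    rewrite -(real_normK (num_real d)) -exprMn.
    have : 0 <= `|d| * e by apply: mulr_ge0; [exact: normr_ge0 | lra].
    by move: (_ * e) hde => m; nra.
  have e20 : 0 < e ^+ 2 by nra.
  rewrite -(ler_pM2r e20); lra.
have lower s t n j : (j < 6)%N -> 8^-1 < 2 ^+ j * (64 ^+ n * `|s - t|) <= 4^-1 ->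
    exists k, `|s - t| <= 196 * (G k s - G k t) ^+ 2.
  move=> j6 /andP[h1 h2].
  have [b hb] : exists b, `|phi (Ordinal j6, b) (64 ^+ n * s) -
      phi (Ordinal j6, b) (64 ^+ n * t)| = 2 ^+ j * (64 ^+ n * `|s - t|).
    have E : 2 ^+ j * (64 ^+ n * `|s - t|) =
        `|2 ^+ j * (64 ^+ n * s) - 2 ^+ j * (64 ^+ n * t)|.
      by rewrite scale -[2 ^+ j * _ - _]mulrBr normrM (@ger0_norm _ (2 ^+ j)) // exprn_ge0.
    rewrite E in h2 *; case: (sawtooth_separates h2) => h.
      by exists false; rewrite /phi /= !addr0.
    by exists true.
  exists (Ordinal j6, b); set k := (Ordinal j6, b) in hb *.
  have := weierstrass_iter (phi_lip k) (HG k).2 n s t.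
  have j2 : 1 <= (2 : R) ^+ j <= 32.
    exact: pow6.
  have := osc k (64 * (64 ^+ n * s)) (64 * (64 ^+ n * t)).
  rewrite !((HG k).2 (64 ^+ n * _)) /= -/k.
  set o := G k _ - G k _ => ho.
  move: h1 h2 hb j2; set f := phi k _ - phi k _.
  rewrite E64; set e := 8 ^+ n; set x := `|s - t|.
  set J := 2 ^+ j => h1 h2 hb /andP[J1 J2].
  have -> : phi k (e ^+ 2 * s) + G k (64 * (e ^+ 2 * s)) / 8 -
    (phi k (e ^+ 2 * t) + G k (64 * (e ^+ 2 * t)) / 8) = f + o / 8.
    by rewrite /f /o E64; field.
  have e0 : 1 <= e by rewrite exprn_ege1 // ler1n.
  have x0 : 0 <= x by exact: normr_ge0.
  set d := G k s - G k t => hd.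
  have e20 : 0 < e ^+ 2 by nra.
  (* The [n]-th term contributes more than 1/8, the earlier terms cancel at most one seventh of it,
     and the tail at most [(4 / 7) / 8 = 1/14]; what remains is [6/7 * 1/8 - 1/14 = 1/28]. Squaring
     and [e ^+ 2 * x <= 4^-1] give [196 = 28 ^+ 2 / 4]. *)
  have de : 28^-1 <= `|d| * e.
    have E : f = (d * e) - (d - (f + o / 8) / e) * e - o / 8.
      by field; rewrite gt_eqF //; lra.
    have : `|f| <= `|d| * e + `|d - (f + o / 8) / e| * e + `|o| / 8.
      have n8 : `|o / 8| = `|o| / 8 by rewrite normrM (@ger0_norm _ 8^-1) ?invr_ge0 ?ler0n.
      have ne : `|e| = e by rewrite ger0_norm //; lra.
      rewrite {1}E; apply: le_trans (ler_normB _ _) _; rewrite n8 lerD2r.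
      by apply: le_trans (ler_normB _ _) _; rewrite !normrM ne.
    rewrite hb.
    have : `|d - (f + o / 8) / e| * e <= J / 7 * (e ^+ 2 * x).
      apply: le_trans (ler_wpM2r _ hd) _; first lra.
      have : (e - 1) * x * e <= e ^+ 2 * x by nra.
      by nra.
    lra.
  have hde2 : 784^-1 <= d ^+ 2 * e ^+ 2.
    rewrite -(real_normK (num_real d)) -exprMn.
    by move: (_ * e) de => m; nra.
  rewrite -(ler_pM2r e20); nra.
exists [seq G k | k <- enum {: 'I_6 * bool}], (1024 * #|{: 'I_6 * bool}|%:R).
split; first by rewrite mulr_gt0 // ltr0n card_prod card_ord card_bool.
move=> s t /andP[s1 s2] /andP[t1 t2].
rewrite /sqdist big_map big_enum /=.
have [->|st] := eqVneq s t.
  rewrite subrr normr0 mulr0 big1; first by rewrite mulr0.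
  by move=> k _; rewrite subrr expr0n.
have x0 : 0 < `|s - t| by rewrite normr_gt0 subr_eq0.
have x4 : `|s - t| <= 4^-1 by rewrite ler_norml; apply/andP; split; lra.
have [n [j [j6 hj]]] := dyadic_scale x0 x4.
split; last first.
  have -> : 1024 * #|{: 'I_6 * bool}|%:R * `|s - t| =
      \sum_(k : 'I_6 * bool) (1024 * `|s - t|).
    by rewrite sumr_const -[RHS]mulr_natl mulrCA mulrA.
  by apply: ler_sum => k _; exact: upper j6 hj.
have [k hk] := lower _ _ _ _ j6 hj.
apply: le_trans hk _; rewrite (bigD1 k) //=.
have : 0 <= \sum_(i | i != k) (G i s - G i t) ^+ 2.
  by apply: sumr_ge0 => i _; exact: sqr_ge0.
rewrite card_prod card_ord card_bool.
have := sqr_ge0 (G k s - G k t); nra.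
Qed.

(** * The Korányi metric *)

Definition horiz2 (R : realType) (p q : pt3 R) : R :=
  (p.1.1 - q.1.1) ^+ 2 + (p.1.2 - q.1.2) ^+ 2.

(** The vertical coordinate of the product of the inverse of [q] with [p] in the Heisenberg
    group. *)
Definition vert (R : realType) (p q : pt3 R) : R :=
  p.2 - q.2 + 2^-1 * (p.1.1 * q.1.2 - q.1.1 * p.1.2).

Lemma horiz2_ge0 (R : realType) (p q : pt3 R) : 0 <= horiz2 p q.
Proof. by rewrite addr_ge0 ?sqr_ge0. Qed.

Lemma dK_sqr (R : realType) (p q : pt3 R) :
  dK p q ^+ 2 = Num.sqrt (horiz2 p q ^+ 2 + (4 * vert p q) ^+ 2).
Proof.
case: p q => [[x y] z] [[x' y'] z']; rewrite /dK /horiz2 /vert /=.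
by rewrite sqr_sqrtr ?sqrtr_ge0 // [(4 * _) ^+ 2]exprMn; congr (Num.sqrt (_ + _)); ring.
Qed.

Lemma sqrt_sqr_ge0 (R : realType) (a b : R) :
  0 <= Num.sqrt (a ^+ 2 + b ^+ 2) /\
  Num.sqrt (a ^+ 2 + b ^+ 2) ^+ 2 = a ^+ 2 + b ^+ 2.
Proof. by rewrite sqrtr_ge0 sqr_sqrtr // addr_ge0 ?sqr_ge0. Qed.

Lemma sqrt_sqr_triangle (R : realType) (a b c d : R) :
  Num.sqrt ((a + c) ^+ 2 + (b + d) ^+ 2) <=
  Num.sqrt (a ^+ 2 + b ^+ 2) + Num.sqrt (c ^+ 2 + d ^+ 2).
Proof.
have [s0 sE] := sqrt_sqr_ge0 a b; have [t0 tE] := sqrt_sqr_ge0 c d.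
set s := Num.sqrt (a ^+ 2 + b ^+ 2) in s0 sE *.
set t := Num.sqrt (c ^+ 2 + d ^+ 2) in t0 tE *.
rewrite -(ler_sqr (x := Num.sqrt _)) ?nnegrE ?sqrtr_ge0 ?addr_ge0 //.
rewrite (sqrt_sqr_ge0 (a + c) (b + d)).2.
have st0 : 0 <= s * t by exact: mulr_ge0.
(* Cauchy-Schwarz, by Lagrange's identity with defect [(a * d - b * c) ^+ 2]. *)
have : a * c + b * d <= s * t.
  apply: le_trans (ler_norm _) _; apply: ler_norm_of_sqr => //.
  rewrite exprMn sE tE; have := sqr_ge0 (a * d - b * c); nra.
nra.
Qed.

(* With [A p = |w|^2 + 4 i t], group multiplication gives
   [A (p p') = A p + A p' + 2 w^* w'], so the square of the gauge, which is [|A|],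
   satisfies [N(p p')^2 <= N(p)^2 + 2 |w| |w'| + N(p')^2]. *)
Lemma dK_pseudometric (R : realType) : pseudometric (@dK R).
Proof.
have dK0 p q : 0 <= dK p q :> R.
  by case: p q => [[? ?] ?] [[? ?] ?]; exact: sqrtr_ge0.
split=> [p|p q|p q r].
- have : dK p p ^+ 2 = 0.
    have -> : 0 = Num.sqrt 0 :> R by rewrite sqrtr0.
    by rewrite dK_sqr /horiz2 /vert; congr Num.sqrt; ring.
  by move/eqP; rewrite sqrf_eq0 => /eqP.
- case: p q => [[? ?] ?] [[? ?] ?]; rewrite /dK; congr (Num.sqrt (Num.sqrt _)); ring.
rewrite -(ler_sqr (x := dK p r)) ?nnegrE ?addr_ge0 // sqrrD !dK_sqr.
set a1 := p.1.1 - q.1.1; set b1 := p.1.2 - q.1.2.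
set a2 := q.1.1 - r.1.1; set b2 := q.1.2 - r.1.2.
have hE : horiz2 p r = (horiz2 p q + horiz2 q r) + 2 * (a1 * a2 + b1 * b2).
  by rewrite /horiz2 /a1 /b1 /a2 /b2; ring.
have vE : 4 * vert p r = (4 * vert p q + 4 * vert q r) + 2 * (b1 * a2 - a1 * b2).
  by rewrite /vert /a1 /b1 /a2 /b2; field.
rewrite hE vE; apply: le_trans (sqrt_sqr_triangle _ _ _ _) _.
have := sqrt_sqr_triangle (horiz2 p q) (4 * vert p q) (horiz2 q r) (4 * vert q r).
rewrite -!dK_sqr.
have [u0 uE] := sqrt_sqr_ge0 (2 * (a1 * a2 + b1 * b2)) (2 * (b1 * a2 - a1 * b2)).
have le2 p' q' : horiz2 p' q' <= dK p' q' ^+ 2 :> R.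
  rewrite dK_sqr; apply: le_trans (ler_norm _) _; rewrite -sqrtr_sqr ler_wsqrtr //.
  by rewrite lerDl sqr_ge0.
set u := Num.sqrt _ in u0 uE *.
suff : u <= 2 * (dK p q * dK q r) by rewrite -mulr_natl; lra.
have dd0 : 0 <= dK p q * dK q r by exact: mulr_ge0.
rewrite -(ler_sqr (x := u)) ?nnegrE ?mulr_ge0 // uE.
(* Multiplicativity of the complex modulus, applied to [2 w^* w']. *)
have -> : (2 * (a1 * a2 + b1 * b2)) ^+ 2 + (2 * (b1 * a2 - a1 * b2)) ^+ 2 =
    4 * (horiz2 p q * horiz2 q r).
  by rewrite /horiz2 -/a1 -/b1 -/a2 -/b2; ring.
have := ler_pM (horiz2_ge0 p q) (horiz2_ge0 q r) (le2 p q) (le2 q r).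
by rewrite !exprMn; lra.
Qed.

(** A Euclidean norm in the plane lies between the maximum and the sum of the two coordinates. The
    sum form allows the horizontal and vertical parts to be embedded separately. *)
Lemma dK_sqr_equiv (R : realType) (p q : pt3 R) :
  horiz2 p q + `|vert p q| <= 4 * dK p q ^+ 2 /\
  dK p q ^+ 2 <= 4 * (horiz2 p q + `|vert p q|).
Proof.
rewrite dK_sqr; have [s0 sE] := sqrt_sqr_ge0 (horiz2 p q) (4 * vert p q).
have h0 := horiz2_ge0 p q; have v0 := normr_ge0 (vert p q).
have vE : (4 * vert p q) ^+ 2 = 16 * `|vert p q| ^+ 2.
  by rewrite real_normK ?num_real // exprMn; congr (_ * _); ring.
set s := Num.sqrt _ in s0 sE *; rewrite vE in sE.
move: (horiz2 _ _) (`|_|) h0 v0 {vE} sE => h v h0 v0 sE.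
have hs : h <= s by rewrite -(ler_sqr (x := h)) ?nnegrE // sE; nra.
have vs : 4 * v <= s by rewrite -(ler_sqr (x := 4 * v)) ?nnegrE ?mulr_ge0 // sE exprMn; nra.
have sv : s <= h + 4 * v.
  rewrite -(ler_sqr (x := s)) ?nnegrE ?addr_ge0 ?mulr_ge0 // sE sqrrD exprMn.
  by have := mulr_ge0 h0 v0; nra.
split; lra.
Qed.

(** * Planes and triangles *)

Lemma embeddable_vertical (R : realType) (A : pt3 R -> Prop) (zeta : pt3 R -> R) (K : R) :
  (forall p, A p -> `|zeta p| <= K) ->
  (forall p q, A p -> A q -> vert p q = zeta p - zeta q) ->
  embeddable A (fun p q => dK p q ^+ 2).
Proof.
(* Dividing by [c] brings [zeta] into the interval of [snowflake_interval]; the absolute value keeps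
   [c] at least 1 even if [K] is negative. *)
move=> zK vE; pose c := 1 + `|K|.
have c0 : 0 < c by rewrite /c; have := normr_ge0 K; lra.
have H : embeddable A (fun p q => ((p.1.1 - q.1.1) ^+ 2 + (p.1.2 - q.1.2) ^+ 2) +
    `|zeta p / c - zeta q / c|).
  apply: embeddable_add; first by apply: embeddable_add; exact: embeddable_sqr.
  apply: embeddable_comp (snowflake_interval R) => p /zK zp.
  rewrite -ler_norml normrM normfV (gtr0_norm c0) ler_pdivrMr // mul1r.
  by apply: le_trans zp _; rewrite /c; have := ler_norm K; lra.
apply: (embeddable_equiv (c := 4 * c)) H; first by rewrite mulr_gt0.
move=> p q Ap Aq; rewrite -mulrBl -vE // normrM normfV (gtr0_norm c0) -/(horiz2 p q).
have [h1 h2] := dK_sqr_equiv p q.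
have := horiz2_ge0 p q; have := normr_ge0 (vert p q).
move: (horiz2 _ _) (`|vert _ _|) (dK _ _ ^+ 2) h1 h2 => h v D h1 h2 v0 h0.
have vc : c * (v / c) = v by rewrite mulrC divfK // gt_eqF.
have vc0 : 0 <= v / c by rewrite divr_ge0 // ltW.
have c1 : 1 <= c by rewrite /c; have := normr_ge0 K; lra.
have D0 : 0 <= D by lra.
split; nra.
Qed.

(** On the plane [z = 0] the wedge term is twice [vert], so this is comparable to [dK ^+ 2]
    there. *)
Definition wedge_dist (R : realType) (P Q : pt2 R) : R :=
  ((P.1 - Q.1) ^+ 2 + (P.2 - Q.2) ^+ 2) + `|P.1 * Q.2 - Q.1 * P.2|.

(** The wedge is the sine of the angle and [c] its cosine. Up to a right angle the sine controls the
    chord; beyond it the squared chord exceeds 2 and suffices. *)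
Lemma unit_arc_le (R : realType) (u1 u2 v1 v2 : R) :
  u1 ^+ 2 + u2 ^+ 2 = 1 -> v1 ^+ 2 + v2 ^+ 2 = 1 ->
  `|u1 - v1| + `|u2 - v2| <= 2 * ((u1 - v1) ^+ 2 + (u2 - v2) ^+ 2 + `|u1 * v2 - v1 * u2|).
Proof.
move=> uE vE; pose m := (u1 - v1) ^+ 2 + (u2 - v2) ^+ 2.
pose c := u1 * v1 + u2 * v2; pose w := u1 * v2 - v1 * u2.
have mE : m = 2 - 2 * c by rewrite /m /c; nra.
have wE : `|w| ^+ 2 = 1 - c ^+ 2 by rewrite real_normK ?num_real // /w /c; nra.
have dE : (`|u1 - v1| + `|u2 - v2|) ^+ 2 <= 2 * m.
  have := real_normK (num_real (u1 - v1)); have := real_normK (num_real (u2 - v2)).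
  have := sqr_ge0 (`|u1 - v1| - `|u2 - v2|); rewrite /m => ? <- <-; nra.
rewrite -/m -/w.
have d0 : 0 <= `|u1 - v1| + `|u2 - v2| by exact: addr_ge0.
have w0 : 0 <= `|w| by exact: normr_ge0.
have m0 : 0 <= m by rewrite addr_ge0 ?sqr_ge0.
move: (`|_| + `|_|) (`|w|) d0 w0 wE dE => d x d0 x0 xE dE.
have [c0|c0] := leP 0 c.
  have : d <= 2 * x by rewrite -(ler_sqr (x := d)) ?nnegrE ?mulr_ge0 // exprMn; nra.
  lra.
have : d <= 2 * m by rewrite -(ler_sqr (x := d)) ?nnegrE ?mulr_ge0 // exprMn; nra.
lra.
Qed.

(* In polar form [P = r u], [Q = s v] with [r <= s], both sides describe the metric
   of a cone over the circle with its snowflaked arc length. *)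
Lemma wedge_dist_polar (R : realType) (r s u1 u2 v1 v2 : R) :
  0 <= r -> r <= s -> u1 ^+ 2 + u2 ^+ 2 = 1 -> v1 ^+ 2 + v2 ^+ 2 = 1 ->
  let X := (r - s) ^+ 2 + r ^+ 2 * (`|u1 - v1| + `|u2 - v2|) in
  let Y := wedge_dist (r * u1, r * u2) (s * v1, s * v2) in
  X <= 3 * Y /\ Y <= 10 * X.
Proof.
move=> r0 rs uE vE X Y.
have arc := unit_arc_le uE vE.
pose m := (u1 - v1) ^+ 2 + (u2 - v2) ^+ 2.
pose d := `|u1 - v1| + `|u2 - v2|; pose w := `|u1 * v2 - v1 * u2|.
have d0 : 0 <= d by exact: addr_ge0.
have w0 : 0 <= w by exact: normr_ge0.
have m0 : 0 <= m by rewrite addr_ge0 ?sqr_ge0.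
have YE : Y = (r - s) ^+ 2 + r * s * (m + w).
  rewrite /Y /wedge_dist /=.
  have -> : r * u1 * (s * v2) - s * v1 * (r * u2) = r * s * (u1 * v2 - v1 * u2) by ring.
  rewrite normrM ger0_norm -/w; last by apply: mulr_ge0; lra.
  rewrite /m mulrDr addrA; congr (_ + _).
  have := congr1 ( *%R (r ^+ 2)) uE; have := congr1 ( *%R (s ^+ 2)) vE.
  have := congr1 ( *%R (r * s)) uE; have := congr1 ( *%R (r * s)) vE; lra.
have XE : X = (r - s) ^+ 2 + r ^+ 2 * d by [].
have [bu1 bu2] : `|u1| <= 1 /\ `|u2| <= 1.
  by split; apply: ler_norm_of_sqr => //; rewrite expr1n; nra.
have [bv1 bv2] : `|v1| <= 1 /\ `|v2| <= 1.
  by split; apply: ler_norm_of_sqr => //; rewrite expr1n; nra.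
have n1 : `|u1 - v1| <= 2 by apply: le_trans (ler_normB _ _) _; lra.
have n2 : `|u2 - v2| <= 2 by apply: le_trans (ler_normB _ _) _; lra.
have md : m <= 2 * d.
  rewrite /m /d -(real_normK (num_real (u1 - v1))) -(real_normK (num_real (u2 - v2))).
  by have := normr_ge0 (u1 - v1); have := normr_ge0 (u2 - v2); nra.
have wd : w <= d.
  rewrite /w; have -> : u1 * v2 - v1 * u2 = (u1 - v1) * u2 - u1 * (u2 - v2) by ring.
  apply: le_trans (ler_normB _ _) _; rewrite !normrM /d.
  by have := normr_ge0 (u1 - v1); have := normr_ge0 (u2 - v2); nra.
rewrite -/m -/d -/w in arc; rewrite XE YE.
have d4 : d <= 4 by rewrite /d; lra.
have rs2 : r ^+ 2 <= r * s by rewrite expr2 ler_wpM2l.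
have mw : 0 <= m + w by lra.
split.
  have h1 : r ^+ 2 * d <= r ^+ 2 * (2 * (m + w)) by rewrite ler_wpM2l ?sqr_ge0.
  have h2 : r ^+ 2 * (m + w) <= r * s * (m + w) by rewrite ler_wpM2r.
  have h3 : 0 <= r * s * (m + w) by apply: mulr_ge0 => //; apply: mulr_ge0; lra.
  have := sqr_ge0 (r - s); lra.
have h1 : r * s * (m + w) <= r * s * (3 * d).
  by rewrite ler_wpM2l //; [apply: mulr_ge0|]; lra.
(* [s] may be much larger than [r]: the excess of [r * s] over a multiple of [r ^+ 2] is absorbed by
   the radial term, as [d] is bounded. *)
have h2 : 2 * (r * s) <= 3 * r ^+ 2 + (r - s) ^+ 2 by have := sqr_ge0 (2 * r - s); nra.
have h3 := ler_wpM2r d0 h2.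
have h4 : (r - s) ^+ 2 * d <= (r - s) ^+ 2 * 4 by rewrite ler_wpM2l ?sqr_ge0.
have h5 : 0 <= r ^+ 2 * d by rewrite mulr_ge0 ?sqr_ge0.
have := sqr_ge0 (r - s); lra.
Qed.

Lemma polar_decomposition (R : realType) (P : pt2 R) :
  exists z : R * (R * R), [/\ 0 <= z.1, z.2.1 ^+ 2 + z.2.2 ^+ 2 = 1 &
    P = (z.1 * z.2.1, z.1 * z.2.2)].
Proof.
case: P => x y; have [r0 rE] := sqrt_sqr_ge0 x y.
set r := Num.sqrt _ in r0 rE.
have [r00|rn0] := eqVneq r 0.
  (* At the origin any unit vector serves as direction. *)
  exists (0, (1, 0)); split=> //=; first by rewrite expr1n expr0n addr0.
  rewrite r00 expr0n /= in rE; rewrite !mul0r.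
  have x0 : x ^+ 2 = 0 by have := sqr_ge0 x; have := sqr_ge0 y; lra.
  have y0 : y ^+ 2 = 0 by have := sqr_ge0 x; have := sqr_ge0 y; lra.
  by move/eqP: x0; move/eqP: y0; rewrite !sqrf_eq0 => /eqP-> /eqP->.
exists (r, (x / r, y / r)); split=> //=.
  by rewrite !expr_div_n -mulrDl -rE divff // expf_neq0.
by rewrite ![r * _]mulrC !divfK.
Qed.

(** Rests on [r * g a - s * g b = r * (g a - g b) + (r - s) * g b], the last term being the radial
    error [N]. *)
Lemma cone_sqdist (R : realType) (T : Type) (gs : seq (T -> R)) (r s : R) (a b : T) :
  let S := \sum_(g <- gs) (r * g a - s * g b) ^+ 2 in
  let N := (r - s) ^+ 2 * \sum_(g <- gs) g b ^+ 2 in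
  S <= 2 * (r ^+ 2 * sqdist gs a b) + 2 * N /\
  r ^+ 2 * sqdist gs a b <= 2 * S + 2 * N.
Proof.
rewrite /sqdist !mulr_sumr -!big_split /=; split; apply: ler_sum => g _.
  by have := sqr_ge0 (r * (g a - g b) - (r - s) * g b); nra.
by have := sqr_ge0 ((r * g a - s * g b) + (r - s) * g b); nra.
Qed.

Lemma embeddable_wedge (R : realType) :
  embeddable (fun=> True) (@wedge_dist R).
Proof.
have [fs [L [L0 Hf]]] := snowflake_interval R.
have /choice[z Hz] := @polar_decomposition R.
(* Coordinates vanishing at 0 are bounded on the interval by the upper embedding estimate against
   the point 0. *)
pose gs := [seq (fun t => f t - f 0) | f <- fs].
have gsE a b : sqdist gs a b = sqdist fs a b.
  by rewrite /sqdist big_map; apply: eq_bigr => f _; congr (_ ^+ 2); ring.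
have gsL b : -1 <= b <= 1 -> \sum_(g <- gs) g b ^+ 2 <= L.
  move=> hb; rewrite big_map; have [] := Hf b 0 hb; first by apply/andP; split; lra.
  move=> _ h; apply: le_trans h _; rewrite subr0.
  have : `|b| <= 1 by rewrite ler_norml.
  by have := normr_ge0 b; nra.
pose F (c : R * R -> R) := [seq (fun P => (z P).1 * g (c (z P).2)) | g <- gs].
exists ((fun P => (z P).1) :: F fst ++ F snd), (40 * (1 + L) ^+ 2).
split; first by nra.
(* By symmetry the first radius is the smaller one, as [wedge_dist_polar] demands. *)
suff H P Q : (z P).1 <= (z Q).1 ->
    let S := sqdist ((fun P => (z P).1) :: F fst ++ F snd) P Q in
    wedge_dist P Q <= 40 * (1 + L) ^+ 2 * S /\ S <= 40 * (1 + L) ^+ 2 * wedge_dist P Q.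
  move=> P Q _ _; have [PQ|/ltW QP] := leP (z P).1 (z Q).1; first exact: H.
  have wC : wedge_dist P Q = wedge_dist Q P.
    by rewrite /wedge_dist [in RHS]distrC; congr (_ + _); ring.
  by rewrite wC sqdist_sym; exact: H.
move=> rs; rewrite sqdist_cons sqdist_cat /=.
have -> : wedge_dist P Q = wedge_dist ((z P).1 * (z P).2.1, (z P).1 * (z P).2.2)
    ((z Q).1 * (z Q).2.1, (z Q).1 * (z Q).2.2).
  by case: (Hz P) => _ _ <-; case: (Hz Q) => _ _ <-.
have [r0 uE _] := Hz P; have [s0 vE _] := Hz Q.
have [h1 h2] := wedge_dist_polar r0 rs uE vE.
have bd (x y : R) : x ^+ 2 + y ^+ 2 = 1 -> -1 <= x <= 1.
  move=> E; rewrite -ler_norml; apply: ler_norm_of_sqr => //.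
  by rewrite expr1n; have := sqr_ge0 y; lra.
have bu1 := bd _ _ uE; have bv1 := bd _ _ vE.
have bu2 := bd _ _ (etrans (addrC _ _) uE); have bv2 := bd _ _ (etrans (addrC _ _) vE).
rewrite /sqdist /F !big_map -!(big_map (fun f t => f t - f 0) xpredT
  (fun g => ((z P).1 * g _ - (z Q).1 * g _) ^+ 2)) -/gs.
move: (wedge_dist _ _) h1 h2 => Y h1 h2.
have [k1 k2] := cone_sqdist gs (z P).1 (z Q).1 (z P).2.1 (z Q).2.1.
have [l1 l2] := cone_sqdist gs (z P).1 (z Q).1 (z P).2.2 (z Q).2.2.
rewrite !gsE in k1 k2 l1 l2.
have [f1 f2] := Hf _ _ bu1 bv1; have [f3 f4] := Hf _ _ bu2 bv2.
have n1 := gsL _ bv1; have n2 := gsL _ bv2.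
have q0 := sqr_ge0 ((z P).1 - (z Q).1).
have r20 := sqr_ge0 (z P).1.
(* Used with [rho] the squared smaller radius and [q] the squared radial difference; the errors in
   [q] are harmless because the radius is itself a coordinate. *)
have comparison (rho q N D d S0 : R) : 0 <= rho -> 0 <= q -> N <= L ->
    d <= L * D -> D <= L * d -> S0 <= 2 * (rho * D) + 2 * (q * N) ->
    rho * D <= 2 * S0 + 2 * (q * N) ->
    S0 <= 2 * L * (rho * d) + 2 * L * q /\ rho * d <= 2 * L * S0 + 2 * L ^+ 2 * q.
  move=> rho0 q0' NL dD Dd SD DS.
  have e1 := ler_wpM2l q0' NL; have e2 := ler_wpM2l rho0 dD.
  have e3 := ler_wpM2l rho0 Dd; split; first lra.
  have : L * (rho * D) <= L * (2 * S0 + 2 * (q * L)) by rewrite ler_pM2l //; lra.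
  lra.
have [a1 a2] := comparison _ _ _ _ _ _ r20 q0 n1 f1 f2 k1 k2.
have [b1 b2] := comparison _ _ _ _ _ _ r20 q0 n2 f3 f4 l1 l2.
set S1 := \sum_(g <- gs) _ in a1 a2 *; set S2 := \sum_(g <- gs) _ in b1 b2 *.
have S10 : 0 <= S1 by apply: sumr_ge0 => g _; exact: sqr_ge0.
have S20 : 0 <= S2 by apply: sumr_ge0 => g _; exact: sqr_ge0.
have d10 := mulr_ge0 r20 (normr_ge0 ((z P).2.1 - (z Q).2.1)).
have d20 := mulr_ge0 r20 (normr_ge0 ((z P).2.2 - (z Q).2.2)).
rewrite mulrDr in h1 h2.
move: (_ ^+ 2 * `|_|) (_ ^+ 2 * `|_|) (_ ^+ 2) S1 S2 S10 S20 q0 d10 d20 a1 a2 b1 b2 h1 h2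
  => e1 e2 q S1 S2 S10 S20 q0 d10 d20 a1 a2 b1 b2 h1 h2.
have L2 : 0 <= L ^+ 2 by exact: sqr_ge0.
have qS : 0 <= S1 + S2 by lra.
split.
  have X : q + (e1 + e2) <= (4 * (1 + L) ^+ 2) * (q + (S1 + S2)).
    have : 0 <= L * q by nra.
    have : 0 <= L * (S1 + S2) by nra.
    have : 0 <= L ^+ 2 * (S1 + S2) by exact: mulr_ge0.
    by rewrite sqrrD; lra.
  lra.
have Y0 : 0 <= Y by lra.
have LY := ler_wpM2l (ltW L0) h1.
have : 0 <= L * q by nra.
have : 0 <= L ^+ 2 * Y by exact: mulr_ge0.
have : 0 <= L * Y by nra.
rewrite sqrrD; nra.
Qed.

(* The left translation [(x, y) |-> (x - 2 b, y + 2 a)] moves the characteristic point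
   of the plane to the origin. *)
Lemma embeddable_graph (R : realType) (A : pt3 R -> Prop) (a b c : R) :
  (forall p, A p -> p.2 = a * p.1.1 + b * p.1.2 + c) ->
  embeddable A (fun p q => dK p q ^+ 2).
Proof.
move=> Az; pose h (p : pt3 R) : pt2 R := (p.1.1 - 2 * b, p.1.2 + 2 * a).
have H : embeddable A (fun p q => wedge_dist (h p) (h q)).
  exact: (@embeddable_comp _ _ _ h) (embeddable_wedge R).
apply: (embeddable_equiv (c := 8)) H => // p q Ap Aq.
have -> : wedge_dist (h p) (h q) = horiz2 p q + 2 * `|vert p q|.
  have E : (h p).1 * (h q).2 - (h q).1 * (h p).2 = 2 * vert p q.
    by rewrite /vert /h /= (Az p Ap) (Az q Aq); field.
  rewrite /wedge_dist E normrM (@ger0_norm _ 2) // /horiz2 /h /=.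
  by congr (_ + _); ring.
have := dK_sqr_equiv p q; have := horiz2_ge0 p q; have := normr_ge0 (vert p q).
by move=> ? ? [? ?]; split; lra.
Qed.

Lemma convex_comb_norm_le (R : realType) (s t u a b c : R) :
  0 <= s -> 0 <= t -> 0 <= u -> s + t + u = 1 ->
  `|s * a + t * b + u * c| <= `|a| + `|b| + `|c|.
Proof.
move=> s0 t0 u0 stu; apply: le_trans (ler_normD _ _) _.
apply: lerD; [apply: le_trans (ler_normD _ _) _; apply: lerD|];
  by rewrite normrM ger0_norm // ler_piMl //; lra.
Qed.

(** [w] is the third component of the normal vector. If it is nonzero, the plane is a graph over the
    [xy]-plane; if it vanishes, the projection is collinear, which includes all degenerate
    triangles. *)
Lemma embeddable_triangle (R : realType) (a b c : pt3 R) :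
  embeddable (triangle a b c) (fun p q => dK p q ^+ 2).
Proof.
case: a b c => [[a1 a2] a3] [[b1 b2] b3] [[c1 c2] c3].
pose w := (b1 - a1) * (c2 - a2) - (b2 - a2) * (c1 - a1).
have [w0|wn0] := eqVneq w 0; last first.
  (* Cramer's rule for the slopes of the plane. *)
  pose al := ((b3 - a3) * (c2 - a2) - (b2 - a2) * (c3 - a3)) / w.
  pose be := ((b1 - a1) * (c3 - a3) - (b3 - a3) * (c1 - a1)) / w.
  apply: (@embeddable_graph _ _ al be (a3 - al * a1 - be * a2)).
  move=> _ [s [t [u [_ _ _ stu ->]]]] /=.
  have -> : s = 1 - t - u by lra.
  by move: wn0; rewrite /al /be /w => wn0; field.
(* The projection to the [xy]-plane lies on a line with direction [m] and
   parameter [l]. *)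
have [m1 [m2 [k [l [E1 E2 E3 E4]]]]] : exists m1 m2 k l : R,
    [/\ b1 - a1 = k * m1, b2 - a2 = k * m2, c1 - a1 = l * m1 & c2 - a2 = l * m2].
  rewrite /w in w0.
  have [u10|un1] := eqVneq (b1 - a1) 0.
    have [u20|un2] := eqVneq (b2 - a2) 0.
      by exists (c1 - a1), (c2 - a2), 0, 1; split; rewrite ?mul0r ?mul1r.
    exists (b1 - a1), (b2 - a2), 1, ((c2 - a2) / (b2 - a2)); split; rewrite ?mul1r ?divfK //.
    move: w0; rewrite u10 mul0r sub0r mulr0 => /eqP; rewrite oppr_eq0 mulf_eq0 (negbTE un2).
    by move/eqP.
  exists (b1 - a1), (b2 - a2), 1, ((c1 - a1) / (b1 - a1)); split; rewrite ?mul1r ?divfK //.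
  rewrite mulrAC; apply: (canRL (mulfK un1)); lra.
(* For points of the line with parameters [l] and [l'], the expression [x * y' - x' * y] equals
   [kap * (l - l')]. Hence [vert] is the difference of [z + 2^-1 * kap * l], whose values at the
   vertices are [za], [zb], [zc]. *)
pose kap := a2 * m1 - a1 * m2.
pose za := a3; pose zb := b3 + 2^-1 * kap * k; pose zc := c3 + 2^-1 * kap * l.
pose par (p : pt3 R) (tu : R * R) := exists s, [/\ 0 <= s, 0 <= tu.1, 0 <= tu.2,
  s + tu.1 + tu.2 = 1 & p = (s * a1 + tu.1 * b1 + tu.2 * c1,
    s * a2 + tu.1 * b2 + tu.2 * c2, s * a3 + tu.1 * b3 + tu.2 * c3)].
(* [zeta] must depend on the point alone, so barycentric coordinates are chosen. A degenerate
   triangle may offer several, but the identity for [vert] holds for any choice. *)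
have /choice[g Hg] : forall p, exists tu,
    triangle (a1, a2, a3) (b1, b2, b3) (c1, c2, c3) p -> par p tu.
  move=> p; have [[s [t [u Hp]]]|np] := pselect (triangle (a1, a2, a3) (b1, b2, b3) (c1, c2, c3) p).
    by exists (t, u) => _; exists s.
  by exists (0, 0) => /np.
pose zeta p := (1 - (g p).1 - (g p).2) * za + (g p).1 * zb + (g p).2 * zc.
apply: (@embeddable_vertical _ _ zeta (`|za| + `|zb| + `|zc|)).
  move=> p /Hg[s [s0 t0 u0 stu _]]; rewrite /zeta.
  apply: convex_comb_norm_le => //; lra.
move=> p q /Hg[s [_ _ _ stu pE]] /Hg[s' [_ _ _ stu' qE]].
rewrite {1}pE {1}qE /vert /zeta /=.
move: (g p) (g q) stu stu' {pE qE} => [t u] [t' u'] /= stu stu'.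
have -> : s = 1 - t - u by lra.
have -> : s' = 1 - t' - u' by lra.
have -> : b1 = a1 + k * m1 by lra.
have -> : b2 = a2 + k * m2 by lra.
have -> : c1 = a1 + l * m1 by lra.
have -> : c2 = a2 + l * m2 by lra.
by rewrite /za /zb /zc /kap; field.
Qed.

Lemma embeddable_polyhedron (R : realType) (M : pt3 R -> Prop) :
  polyhedron M -> embeddable M (fun p q => dK p q ^+ 2).
Proof.
case=> T MT.
suff H : embeddable (fun p => exists2 abc, abc \in T & triangle abc.1.1 abc.1.2 abc.2 p)
    (fun p q => dK p q ^+ 2).
  by apply: embeddable_sub H => p /MT.
elim: T {MT} => [|abc T IH].
  by exists [::], 1; split=> // p q [].
have H := embeddable_union (dK_pseudometric R) (embeddable_triangle abc.1.1 abc.1.2 abc.2) IH.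
apply: embeddable_sub H => p [x]; rewrite inE => /orP[/eqP->|xT] xp; first by left.
by right; exists x.
Qed.

Theorem theorem1p2 (R : realType) (M : pt3 R -> Prop) :
  compact_PL_2manifold M -> exists N : nat, Lip_finite M N.
Proof.
case=> /embeddable_polyhedron[fs [L [L0 H]]] _.
exists (size fs), (fun p => \row_(i < size fs) nth (fun=> 0) fs i p), (1 + L).
split=> [|p q Mp Mq]; first lra.
have -> : euclN (\row_(i < size fs) nth (fun=> 0) fs i p)
    (\row_(i < size fs) nth (fun=> 0) fs i q) = Num.sqrt (sqdist fs p q).
  rewrite /euclN /sqdist (big_nth (fun=> 0)) big_mkord; congr Num.sqrt.
  by apply: eq_bigr => i _; rewrite !mxE.
have [h1 h2] := H p q Mp Mq.
have s0 := sqdist_ge0 fs p q; have d0 := pseudometric_ge0 p q (dK_pseudometric R).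
have r0 := sqrtr_ge0 (sqdist fs p q); have rE := sqr_sqrtr s0.
(* This turns the estimates for squares into estimates for distances with constant [1 + L]. *)
have L1 : L <= (1 + L) ^+ 2 by nra.
have L01 : 0 <= 1 + L by lra.
split.
  rewrite ler_pdivrMl; last lra.
  rewrite -(ler_sqr (x := dK p q)) ?nnegrE ?mulr_ge0 // exprMn rE.
  by apply: le_trans h1 _; rewrite ler_wpM2r.
rewrite -(ler_sqr (x := Num.sqrt _)) ?nnegrE ?mulr_ge0 // exprMn rE.
by apply: le_trans h2 _; rewrite ler_wpM2r ?sqr_ge0.
Qed.
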